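(* Let $\mathcal{C}$ be a class of $T_0$ topological vector spaces that is closed under quotients with closed subspaces and closed under closed graphs. Then the open-mapping property (O), the continuous-inverse property (C), and the closed-graph property (G) are equivalent for $\mathcal{C}$.
   Context: All topological vector spaces (t.v.s.) are assumed to be $T_0$ (hence Hausdorff), over the scalar field $\mathbb{R}$ or $\mathbb{C}$. A map $u\colon E\to F$ is called closed if its graph $\mathrm{Graph}(u)=\{(e,u(e))\mid e\in E\}$ is a closed subset of $E\times F$. A map $u\colon E\to F$ is called open if for every open set $O\subseteq E$ the image $u(O)$ is open in $u(E)$. For a class $\mathcal{C}$ of t.v.s. define: (O) Open-mapping property: for all $E,F$ in $\mathcal{C}$, every surjective, linear, continuous map $u\colon E\to F$ is open. (C) Continuous-inverse property: for all $E,F$ in $\mathcal{C}$, every bijective linear map $u\colon E\to F$ is continuous if and only if its inverse $u^{-1}$ is continuous. (G) Closed-graph property: for all $E,F$ in $\mathcal{C}$, every linear map $u\colon E\to F$ is closed if and only if it is continuous. $\mathcal{C}$ is closed under closed graphs if for all $E,F$ in $\mathcal{C}$ and every linear, closed map $u\colon E\to F$, the space $\mathrm{Graph}(u)$ (a subspace of $E\times F$ with the subspace topology) is in $\mathcal{C}$. $\mathcal{C}$ is closed under quotients with closed subspaces if for every $E$ in $\mathcal{C}$ and every closed linear subspace $A$ of $E$, the quotient space $E/A$ is in $\mathcal{C}$. *)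

(* Defs.v *)
From HB Require Import structures.
From mathcomp Require Import all_boot all_algebra.
From mathcomp Require Import all_classical all_reals all_analysis.
From mathcomp Require Import complex.

Set Implicit Arguments.
Unset Strict Implicit.
Unset Printing Implicit Defensive.

Import GRing.Theory Num.Theory.
Import numFieldNormedType.Exports.

Local Open Scope classical_set_scope.
Local Open Scope ring_scope.

Section Graph.
Context {K : numFieldType} {E F : topologicalLmodType K}.

Definition graph (u : E -> F) : set (E * F) := [set (e, u e) | e in [set: E]].

Definition closed_map (u : E -> F) : Prop := closed (graph u).

(* u @` O is only required to be open relative to the range of u. *)
Definition open_map (u : E -> F) : Prop := forall O : set E, open O ->
  exists2 V : set F, open V & u @` O = V `&` range u.

(* The subtype of points of the graph: the topology is the one induced by
   E * F, the linear structure is inherited from E * F. *)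
Definition graph_space (u : {linear E -> F}) : Type := set_type (graph u).

Section GraphSpace.
Variable u : {linear E -> F}.
Local Notation G := (graph_space u).

HB.instance Definition _ := SubChoice.on G.
HB.instance Definition _ := Topological.copy G (set_type (graph u)).

Lemma graph_subsemimod_closed :
  subsemimod_closed (fun p : E * F => p \in graph u).
Proof.
split; [split=> [|x y]|move=> a x]; rewrite !inE /graph/=.
- by exists 0; rewrite ?linear0.
- move=> [e _ <-] [f _ <-]; exists (e + f) => //.
  by rewrite linearD.
- by move=> [e _ <-]; exists (a *: e) => //; rewrite linearZ.
Qed.

HB.instance Definition _ := GRing.SubChoice_isSubLmodule.Build
  K (E * F)%type (fun p : E * F => p \in graph u) G graph_subsemimod_closed.

Let val_continuous : continuous (val : G -> E * F).
Proof. exact: initial_continuous. Qed.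

Let continuous_val (T : topologicalType) (f : T -> G) :
  continuous (fun t => (val (f t)).1) -> continuous (fun t => (val (f t)).2) ->
  continuous f.
Proof.
move=> f1 f2; apply/continuous_comp_initial => t /=.
have -> : \val \o f = (fun t => ((val (f t)).1, (val (f t)).2)).
  by apply/funext => z /=; rewrite -surjective_pairing.
exact: (cvg_pair (f1 t) (f2 t)).
Qed.

Let val1_continuous : continuous (fun x : G => (val x).1).
Proof.
move=> x; apply: (@continuous_comp _ _ _ (val : G -> E * F) fst).
  exact: val_continuous.
exact: cvg_fst.
Qed.

Let val2_continuous : continuous (fun x : G => (val x).2).
Proof.
move=> x; apply: (@continuous_comp _ _ _ (val : G -> E * F) snd).
  exact: val_continuous.
exact: cvg_snd.
Qed.

Lemma graph_add_continuous : continuous (fun x : G * G => x.1 + x.2).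
Proof.
apply: continuous_val => x /=.
- apply: (@continuous_comp _ _ _ (fun x : G * G => ((val x.1).1, (val x.2).1))
    (fun x => x.1 + x.2)); last exact: add_continuous.
  exact: (cvg_pair (continuous_comp (@cvg_fst _ _ _ _ _) (@val1_continuous _))
                   (continuous_comp (@cvg_snd _ _ _ _ _) (@val1_continuous _))).
- apply: (@continuous_comp _ _ _ (fun x : G * G => ((val x.1).2, (val x.2).2))
    (fun x => x.1 + x.2)); last exact: add_continuous.
  exact: (cvg_pair (continuous_comp (@cvg_fst _ _ _ _ _) (@val2_continuous _))
                   (continuous_comp (@cvg_snd _ _ _ _ _) (@val2_continuous _))).
Qed.

Lemma graph_scale_continuous : continuous (fun z : K^o * G => z.1 *: z.2).
Proof.
apply: continuous_val => x /=.
- apply: (@continuous_comp _ _ _ (fun x : K^o * G => (x.1, (val x.2).1))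
    (fun x : K^o * E => x.1 *: x.2)); last exact: scale_continuous.
  exact: (cvg_pair (@cvg_fst _ _ _ _ _)
                   (continuous_comp (@cvg_snd _ _ _ _ _) (@val1_continuous _))).
- apply: (@continuous_comp _ _ _ (fun x : K^o * G => (x.1, (val x.2).2))
    (fun x : K^o * F => x.1 *: x.2)); last exact: scale_continuous.
  exact: (cvg_pair (@cvg_fst _ _ _ _ _)
                   (continuous_comp (@cvg_snd _ _ _ _ _) (@val2_continuous _))).
Qed.

HB.instance Definition _ :=
  PreTopologicalNmodule_isTopologicalNmodule.Build G graph_add_continuous.
HB.instance Definition _ :=
  TopologicalNmodule_isTopologicalLmodule.Build K G graph_scale_continuous.

End GraphSpace.
End Graph.

Section Quotient.
Context {K : numFieldType} {E : topologicalLmodType K}.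
Variable A : submodClosed E.

(* submodClosed does not carry closure under opposites, which the quotient of
   an additive group requires; it is recovered from scaling by -1. *)
Definition submod_pred : {pred E} := fun x => x \in A.

Lemma submod_pred_zmod_closed : zmod_closed submod_pred.
Proof. exact: GRing.submod_closedB (submodClosedP A). Qed.

HB.instance Definition _ :=
  GRing.isZmodClosed.Build E submod_pred submod_pred_zmod_closed.

(* E modulo x ~ y := x - y \in A, with the finest topology making the
   projection continuous. *)
Definition quotient_space : Type :=
  quotient_topology (Quotient.quot submod_pred).
Local Notation Q := quotient_space.

HB.instance Definition _ := Topological.on Q.
HB.instance Definition _ := @GRing.isZmodule.Build Q _ _ _
  (@Quotient.addqA E submod_pred) (@Quotient.addqC E submod_pred)
  (@Quotient.add0q E submod_pred) (@Quotient.addNq E submod_pred).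

Definition quotient_pi : E -> Q := \pi_(Quotient.quot submod_pred)%qT.

Definition quotient_scale (a : K) (x : Q) : Q :=
  quotient_pi (a *: repr (x : Quotient.quot submod_pred)).

Lemma quotient_piK (x : Q) : exists e, quotient_pi e = x.
Proof. by exists (repr (x : Quotient.quot submod_pred)); exact: reprK. Qed.

Lemma quotient_piP (x y : E) :
  reflect (quotient_pi x = quotient_pi y) (x - y \in A).
Proof.
rewrite -[x - y \in A]/(x - y \in submod_pred) Quotient.idealrBE.
by apply: (iffP eqP).
Qed.

Lemma quotient_piD : {morph quotient_pi : x y / x + y}.
Proof. exact: (@Quotient.pi_add E submod_pred). Qed.

Lemma quotient_piZ (a : K) (x : E) :
  quotient_pi (a *: x) = quotient_scale a (quotient_pi x).
Proof.
apply/quotient_piP; rewrite -scalerBr rpredZ//; apply/quotient_piP.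
by rewrite /quotient_pi reprK.
Qed.

Let scaleA a b x :
  quotient_scale a (quotient_scale b x) = quotient_scale (a * b) x.
Proof. by have [e <-] := quotient_piK x; rewrite -!quotient_piZ scalerA. Qed.

Let scale1 : left_id 1 quotient_scale.
Proof.
by move=> x; have [e <-] := quotient_piK x; rewrite -quotient_piZ scale1r.
Qed.

Let scaleDr : right_distributive quotient_scale +%R.
Proof.
move=> a x y; have [e <-] := quotient_piK x; have [f <-] := quotient_piK y.
by rewrite -quotient_piD -!quotient_piZ scalerDr quotient_piD.
Qed.

Let scaleDl x : {morph quotient_scale^~ x : a b / a + b}.
Proof.
move=> a b; have [e <-] := quotient_piK x.
by rewrite -!quotient_piZ scalerDl quotient_piD.
Qed.

HB.instance Definition _ := GRing.Zmodule_isLmodule.Build K Q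
  scaleA scale1 scaleDr scaleDl.

Lemma quotient_pi_linear : linear quotient_pi.
Proof. by move=> a x y; rewrite quotient_piD quotient_piZ. Qed.

HB.instance Definition _ :=
  GRing.isLinear.Build K E Q *:%R quotient_pi quotient_pi_linear.

Lemma quotient_pi_continuous : continuous quotient_pi.
Proof. exact: pi_continuous. Qed.

Lemma quotient_pi_nbhs (x : E) (U : set E) :
  nbhs x U -> nbhs (quotient_pi x) (quotient_pi @` U).
Proof.
rewrite nbhsE => -[V [oV Vx] VU].
rewrite nbhsE; exists (quotient_pi @` V); last exact: image_subset.
split; last by exists x.
suff : open (quotient_pi @^-1` (quotient_pi @` V)) by [].
rewrite openE => y /= [v Vv /quotient_piP vy].
have tc : continuous (fun z : E => z + (v - y)).
  move=> z; apply: (@continuous_comp _ _ _ (fun z => (z, v - y))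
    (fun x : E * E => x.1 + x.2)); last exact: add_continuous.
  by apply: cvg_pair => /=; [exact: cvg_id|exact: cvg_cst].
have : nbhs y ((fun z => z + (v - y)) @^-1` V).
  by apply: tc => /=; apply: open_nbhs_nbhs; split=> //; rewrite subrKC.
apply: filterS => z Vz; exists (z + (v - y)) => //.
by apply/quotient_piP; rewrite addrAC subrr add0r.
Qed.

Lemma quotient_add_continuous : continuous (fun x : Q * Q => x.1 + x.2).
Proof.
move=> [x y]; have [e <-] := quotient_piK x; have [f <-] := quotient_piK y.
rewrite /continuous_at /= -quotient_piD => U /quotient_pi_continuous nU.
have [/= [B C] [/= nB nC] BC] := @add_continuous E (e, f) _ nU.
exists (quotient_pi @` B, quotient_pi @` C).
  by split; exact: quotient_pi_nbhs.
move=> [_ _] [/= [b Bb <-] [c Cc <-]]; rewrite -quotient_piD.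
exact: (BC (b, c)).
Qed.

Lemma quotient_scale_continuous : continuous (fun z : K^o * Q => z.1 *: z.2).
Proof.
move=> [a x]; have [e <-] := quotient_piK x.
rewrite /continuous_at /= -linearZ => U /quotient_pi_continuous nU.
have [/= [B C] [/= nB nC] BC] := @scale_continuous K E (a, e) _ nU.
exists (B, quotient_pi @` C); first by split=> //; exact: quotient_pi_nbhs.
by move=> [b _] [/= Bb [c Cc <-]]; rewrite -linearZ; exact: (BC (b, c)).
Qed.

HB.instance Definition _ :=
  PreTopologicalNmodule_isTopologicalNmodule.Build Q quotient_add_continuous.
HB.instance Definition _ :=
  TopologicalNmodule_isTopologicalLmodule.Build K Q quotient_scale_continuous.

End Quotient.

Variant scalars := RealScalars | ComplexScalars.

Definition scalar_field (R : realType) (k : scalars) : numFieldType :=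
  match k with RealScalars => R | ComplexScalars => R[i] end.

Section Classes.
Context {K : numFieldType}.
(* topologicalLmodType does not include local convexity or separation; C need
   not be invariant under isomorphism. *)
Variable C : topologicalLmodType K -> Prop.

Definition open_mapping_property : Prop :=
  forall E F : topologicalLmodType K, C E -> C F ->
  forall u : {linear E -> F}, set_surj [set: E] [set: F] u -> continuous u ->
  open_map u.

(* A bijective u is given together with its two-sided inverse v. *)
Definition continuous_inverse_property : Prop :=
  forall E F : topologicalLmodType K, C E -> C F ->
  forall (u : {linear E -> F}) (v : F -> E), cancel u v -> cancel v u ->
  (continuous u <-> continuous v).

Definition closed_graph_property : Prop :=
  forall E F : topologicalLmodType K, C E -> C F ->
  forall u : {linear E -> F}, closed_map u <-> continuous u.

Definition closed_under_closed_graphs : Prop :=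
  forall E F : topologicalLmodType K, C E -> C F ->
  forall u : {linear E -> F}, closed_map u -> C (graph_space u).

Definition closed_under_closed_quotients : Prop :=
  forall E : topologicalLmodType K, C E ->
  forall A : submodClosed E, closed [set x | x \in A] -> C (quotient_space A).

End Classes.

(* Main.v *)
(* (C) => (O): a continuous linear surjection u factors through the quotient
   by its closed kernel as a continuous linear bijection, whose inverse is
   continuous by (C), and the quotient projection is open.
   (C) => (G): if u is closed then the projection of its graph onto the domain
   is a continuous linear bijection, so its inverse is continuous, and u is
   this inverse followed by the second projection.
   (G) => (C): the graphs of u and of its inverse are exchanged by the swap.
   A T0 topological vector space is Hausdorff, so kernels and graphs of
   continuous linear maps are closed. *)
Require Import Defs.
From HB Require Import structures.
From mathcomp Require Import all_boot all_algebra.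
From mathcomp Require Import all_classical all_reals all_analysis.

Set Implicit Arguments.
Unset Strict Implicit.
Unset Printing Implicit Defensive.

Import GRing.Theory.

Local Open Scope classical_set_scope.
Local Open Scope ring_scope.

(** * Separation, closed graphs, and open maps with their inverses *)

Section Topology.
Context {K : numFieldType}.
Implicit Types E F : topologicalLmodType K.

Lemma kolmogorov_hausdorff E : kolmogorov_space E -> hausdorff_space E.
Proof.
(* By [sep], points without disjoint neighbourhoods lie in each other's neighbourhoods. Clustering
   is symmetric, so both alternatives of T0 are refuted. *)
suff sep (p q : E) A : cluster (nbhs p) q -> A \in nbhs p -> A q.
  move=> T0 p q pq; apply/eqP; apply: contrapT => /negP/T0[A].
  case=> -[nA]; rewrite inE; apply; first exact: sep nA.
  by apply: sep nA => U V nU nV; rewrite setIC; exact: pq.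
move=> pq; rewrite inE => nA.
(* (a, b) |-> a - b + q takes the value p at (p, q) and q on the diagonal. *)
have dc : continuous (fun x : E * E => x.1 - x.2 + q).
  move=> x; apply: (@continuous_comp _ _ _ (fun x : E * E => (x.1 - x.2, q))
    (fun x : E * E => x.1 + x.2)); last exact: add_continuous.
  by apply: cvg_pair => /=; [exact: sub_continuous|exact: cvg_cst].
have [|[B D] [/= nB nD] BD] := dc (p, q) A; first by rewrite /= subrK.
have [z [Bz Dz]] := pq _ _ nB nD.
by have := BD (z, z) (conj Bz Dz); rewrite /= subrr add0r.
Qed.

Lemma continuous_closed_map E F (u : E -> F) :
  hausdorff_space F -> continuous u -> closed_map u.
Proof.
move=> hF cu [e f] clef; exists e => //; congr pair.
(* For [(e, f)] in the closure of the graph, a graph point above the preimage of [U] with second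
   coordinate in [V] gives a common point of [U] and [V]. *)
apply: hF => U V nU nV.
have [_ [[x _ <-] [/= Ux Vx]]] : graph u `&` ((u @^-1` U) `*` V) !=set0.
  apply: clef; exists (u @^-1` U, V) => //=.
  by split=> //; exact: cu.
by exists (u x).
Qed.

Lemma closed_map_inverse E F (u : E -> F) (v : F -> E) :
  cancel u v -> cancel v u -> closed_map u -> closed_map v.
Proof.
move=> uK vK clu.
rewrite /closed_map; have -> : graph v = (fun x : F * E => (x.2, x.1)) @^-1` graph u.
  apply/seteqP; split=> [_ [y _ <-]|[y x] [z _ [<- <-]]].
    by exists (v y); rewrite //= vK.
  by exists (u z); rewrite ?uK.
apply: preimage_closed clu => x _; exact: swap_continuous.
Qed.

Lemma open_map_inverse_continuous E F (u : E -> F) (v : F -> E) :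
  cancel u v -> cancel v u -> open_map u -> continuous v.
Proof.
move=> uK vK ou; apply/continuousP => O /ou[V oV uOV].
(* Since [u] is onto, openness relative to its range is openness in [F], and the preimage under [v]
   is the image under [u]. *)
suff -> : v @^-1` O = V by [].
apply/seteqP; split=> y /= Py.
  suff : (u @` O) y by rewrite uOV => -[].
  by exists (v y).
suff : (u @` O) y by move=> [x Ox <-]; rewrite uK.
by rewrite uOV; split=> //; exists (v y).
Qed.

Lemma inverse_continuous_open_map E F (u : E -> F) (v : F -> E) :
  cancel u v -> cancel v u -> continuous v -> open_map u.
Proof.
move=> uK vK /continuousP cv O /cv oO; exists (v @^-1` O) => //.
apply/seteqP; split=> [_ [x Ox <-]|y [Oy _]].
  by split; [rewrite /= uK|exists x].
by exists (v y).
Qed.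

(** Openness is relative to the range; surjectivity of [p] makes its images of open sets open in all
    of [F], so that [u] can be applied to them. *)
Lemma open_map_comp E F (G : topologicalLmodType K) (p : E -> F) (u : F -> G) :
  range p = setT -> open_map p -> open_map u -> open_map (u \o p).
Proof.
move=> rp op ou O /op[V oV]; rewrite rp setIT => pO.
have [W oW uV] := ou _ oV; exists W => //.
have -> : range (u \o p) = range u by rewrite -(image_comp p u) rp.
by rewrite -(image_comp p u) pO uV.
Qed.

(** (O) and (G) quantify over bundled linear maps, whereas the inverse in (C) is a bare function. *)
Lemma linear_inverse E F (u : {linear E -> F}) (v : F -> E) :
  cancel u v -> cancel v u -> {w : {linear F -> E} | w =1 v}.
Proof.
move=> uK vK; pose L := GRing.isLinear.Build K F E *:%R v (can2_linear uK vK).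
pose w : {linear F -> E} := HB.pack v L.
by exists w.
Qed.

End Topology.

(** * The graph as a linear copy of the domain *)

Section GraphProjection.
Context {K : numFieldType} {E F : topologicalLmodType K}.
Variable u : {linear E -> F}.

Definition graph_fst (x : graph_space u) : E := (val x).1.

Lemma graph_fst_linear : linear graph_fst.
Proof. by move=> a x y; rewrite /graph_fst linearP. Qed.

HB.instance Definition _ :=
  GRing.isLinear.Build K (graph_space u) E *:%R graph_fst graph_fst_linear.

Definition graph_pair (e : E) : graph_space u :=
  SigSub (mem_set (ex_intro2 _ _ e I erefl) : (e, u e) \in graph u).

Lemma graph_pairK : cancel graph_pair graph_fst.
Proof. by []. Qed.

Lemma graph_fstK : cancel graph_fst graph_pair.
Proof.
move=> x; apply: val_inj; rewrite /= /graph_fst /=.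
by have /set_mem[e _ /= <-] := valP x.
Qed.

Lemma graph_val_continuous : continuous (val : graph_space u -> E * F).
Proof. exact: initial_continuous. Qed.

Lemma graph_fst_continuous : continuous graph_fst.
Proof.
move=> x; apply: (@continuous_comp _ _ _ (val : graph_space u -> E * F) fst).
  exact: graph_val_continuous.
exact: cvg_fst.
Qed.

Lemma graph_pair_continuous_map : continuous graph_pair -> continuous u.
Proof.
move=> cp e; apply: (@continuous_comp _ _ _ (val \o graph_pair) snd).
  by apply: continuous_comp; [exact: cp|exact: graph_val_continuous].
exact: cvg_snd.
Qed.

End GraphProjection.

(** * Factoring through the kernel *)

Section KernelQuotient.
Context {K : numFieldType} {E F : topologicalLmodType K}.
Variable u : {linear E -> F}.

(** A predicate rather than a set, so that it can carry the [submodClosed] structure expected by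
    [quotient_space]. *)
Definition kernel : {pred E} := fun x => u x == 0.

Lemma kernel_submod_closed : subsemimod_closed kernel.
Proof.
split; [split=> [|x y]|move=> a x]; rewrite !unfold_in /kernel ?linear0//.
  by rewrite linearD => /eqP-> /eqP->; rewrite addr0.
by rewrite linearZ /= => /eqP->; rewrite scaler0.
Qed.

HB.instance Definition _ :=
  GRing.isSubmodClosed.Build K E kernel kernel_submod_closed.

Lemma kernel_closed : hausdorff_space F -> continuous u ->
  closed [set x | x \in kernel].
Proof.
move=> hF cu.
have -> : [set x | x \in kernel] = u @^-1` [set 0].
  by apply/seteqP; split=> x /eqP.
apply: preimage_closed => [x _|]; first exact: cu.
exact/accessible_closed_set1/hausdorff_accessible.
Qed.

Local Notation Q := (quotient_space kernel).

(** Uses a chosen representative; [kernel_lift_pi] shows that the choice is irrelevant. *)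
Definition kernel_lift (x : Q) : F := u (sval (cid (quotient_piK x))).

Lemma kernel_lift_pi (e : E) : kernel_lift (quotient_pi kernel e) = u e.
Proof.
rewrite /kernel_lift; case: cid => f /= /quotient_piP.
by rewrite unfold_in /kernel linearB subr_eq0 => /eqP.
Qed.

Lemma kernel_lift_linear : linear kernel_lift.
Proof.
move=> a x y; have [e <-] := quotient_piK x; have [f <-] := quotient_piK y.
by rewrite -linearP !kernel_lift_pi linearP.
Qed.

HB.instance Definition _ :=
  GRing.isLinear.Build K Q F *:%R kernel_lift kernel_lift_linear.

Lemma kernel_lift_inj : injective kernel_lift.
Proof.
move=> x y; have [e <-] := quotient_piK x; have [f <-] := quotient_piK y.
rewrite !kernel_lift_pi => uef; apply/quotient_piP.
by rewrite unfold_in /kernel linearB uef subrr.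
Qed.

Lemma kernel_lift_continuous : continuous u -> continuous kernel_lift.
Proof.
move=> cu x; have [e <-] := quotient_piK x.
(* The projection is open, so it sends the preimage of [U] under [u] to a neighbourhood, which the
   lift maps into [U]. *)
rewrite /continuous_at kernel_lift_pi => U /cu/(quotient_pi_nbhs kernel).
apply: filterS => _ [f Uf <-].
by rewrite /= kernel_lift_pi.
Qed.

End KernelQuotient.

Lemma quotient_pi_open_map {K : numFieldType} {E : topologicalLmodType K}
  (A : submodClosed E) : open_map (quotient_pi A).
Proof.
move=> O oO; exists (quotient_pi A @` O).
  rewrite openE => _ [x Ox <-]; apply: quotient_pi_nbhs.
  exact: open_nbhs_nbhs.
by apply/esym/setIidl => _ [x _ <-]; exists x.
Qed.

(** * Implications between (O), (C) and (G) *)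

Section Classes.
Context {K : numFieldType}.
Variable C : topologicalLmodType K -> Prop.

(** (O) makes a continuous linear bijection open, hence its inverse continuous; the converse is the
    same argument for the inverse, which is linear too. *)
Lemma open_mapping_continuous_inverse :
  open_mapping_property C -> continuous_inverse_property C.
Proof.
move=> O E F CE CF u v uK vK; split=> [cu|cv].
  apply: (open_map_inverse_continuous uK vK); apply: O => //.
  by move=> y _; exists (v y).
have [w wv] := linear_inverse uK vK; move/funext: wv => wv.
apply: (open_map_inverse_continuous vK uK); rewrite -wv.
by apply: O; rewrite ?wv// => x _; exists (u x).
Qed.

Lemma continuous_inverse_closed_graph :
  (forall E, C E -> hausdorff_space E) -> closed_under_closed_graphs C ->
  continuous_inverse_property C -> closed_graph_property C.
Proof.
move=> hC gC CI E F CE CF u; split=> [clu|cu]; last first.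
  exact/continuous_closed_map/cu/hC.
apply: graph_pair_continuous_map.
apply/(CI (graph_space u) E _ CE (@graph_fst K E F u : {linear _ -> _})).
- exact: gC.
- exact: graph_fstK.
- exact: graph_pairK.
- exact: graph_fst_continuous.
Qed.

Lemma closed_graph_continuous_inverse :
  closed_graph_property C -> continuous_inverse_property C.
Proof.
move=> CG E F CE CF u v uK vK.
have [w /funext wv] := linear_inverse uK vK; rewrite -wv in uK vK *.
split=> /CG cl; apply/CG => //; first exact: closed_map_inverse uK vK (cl _ _).
exact: closed_map_inverse vK uK (cl _ _).
Qed.

Lemma continuous_inverse_open_mapping :
  (forall E, C E -> hausdorff_space E) -> closed_under_closed_quotients C ->
  continuous_inverse_property C -> open_mapping_property C.
Proof.
move=> hC qC CI E F CE CF u su cu.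
have CQ : C (quotient_space (kernel u)).
  exact/qC/kernel_closed/cu/hC.
have pis (y : F) : exists x, kernel_lift (u := u) x = y.
  have [e _ <-] := su y I.
  by exists (quotient_pi (kernel u) e); exact: kernel_lift_pi.
pose v y := sval (cid (pis y)).
have vK : cancel v (kernel_lift (u := u)) by move=> y; exact: (svalP (cid (pis y))).
have uK : cancel (kernel_lift (u := u)) v.
  by move=> x; apply: kernel_lift_inj; rewrite vK.
have -> : (u : E -> F) = kernel_lift (u := u) \o quotient_pi (kernel u).
  by apply/funext => e; rewrite /= kernel_lift_pi.
apply: open_map_comp.
- by apply/seteqP; split=> // x _; have [e <-] := quotient_piK x; exists e.
- exact: quotient_pi_open_map.
- apply: (inverse_continuous_open_map uK vK).
  apply/(CI _ _ CQ CF (kernel_lift (u := u) : {linear _ -> _}) v uK vK).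
  exact: kernel_lift_continuous.
Qed.

End Classes.

Theorem theorem1 (R : realType) (k : scalars)
    (C : topologicalLmodType (scalar_field R k) -> Prop)
    (C_T0 : forall E : topologicalLmodType (scalar_field R k),
      C E -> kolmogorov_space E)
    (C_quotients : closed_under_closed_quotients C)
    (C_graphs : closed_under_closed_graphs C) :
  (open_mapping_property C <-> continuous_inverse_property C) /\
  (continuous_inverse_property C <-> closed_graph_property C).
Proof.
(* Hausdorffness closes kernels in (C) => (O) and graphs of continuous maps in (C) => (G). *)
have hC E : C E -> hausdorff_space E by move=> /C_T0; exact: kolmogorov_hausdorff.
split; split.
- exact: open_mapping_continuous_inverse.
- exact: continuous_inverse_open_mapping.
- exact: continuous_inverse_closed_graph.
- exact: closed_graph_continuous_inverse.
Qed.
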